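(* The family of measures $\{\tilde{\hat\mu}_t\}_{t\in J}$ on $\widehat P$ is weakly continuous: if $t_i\to t_*$ in $J$ then $\int_{\widehat P}\alpha\,d\tilde{\hat\mu}_{t_i}\to\int_{\widehat P}\alpha\,d\tilde{\hat\mu}_{t_*}$ for every $\alpha\in C(\widehat P,\mathbb R)$.
   Context: Let $I=[-1,1]$, $J=(1,2]$, and for $t\in J$ let $f_t\colon I\to I$, $f_t(x)=\min\big(t(x-1)+3,\ t(1-x)-1\big)$ be the core tent map of slope $t$. Let $\mu_t$ be the unique absolutely continuous (with respect to Lebesgue) $f_t$-invariant Borel probability measure on $I$ (it is ergodic). It is known (Alves–Pumariño) that the densities of $\mu_t$ vary continuously in $L^1$, so $t\mapsto\mu_t$ is weakly continuous. For a compact metric space $X$ and continuous surjection $g\colon X\to X$, $\varprojlim(X,g)=\{\langle x_0,x_1,\dots\rangle\in X^{\mathbb N}: g(x_{n+1})=x_n\}$ with product topology, projections $\pi_n$, and natural extension $\hat g(\langle x_0,x_1,\dots\rangle)=\langle g(x_0),x_0,x_1,\dots\rangle$; each $g$-invariant Borel probability $\nu$ induces a unique $\hat g$-invariant Borel probability $\hat\nu$ with $(\pi_n)_*\hat\nu=\nu$ for all $n$. Let $\hat I_t=\varprojlim(I,f_t)$ and $\hat\mu_t$ the measure induced by $\mu_t$. Let $P=I\times J$, $F(x,t)=(f_t(x),t)$, $\widehat P=\varprojlim(P,F)$, and $\iota_t\colon\hat I_t\to\widehat P$, $\iota_t(\langle x_0,x_1,\dots\rangle)=\langle(x_0,t),(x_1,t),\dots\rangle$.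 Define $\tilde{\hat\mu}_t=(\iota_t)_*\hat\mu_t$. *)

(* Defs.v *)
From HB Require Import structures.
From mathcomp Require Import all_boot all_order all_algebra.
From mathcomp Require Import all_classical all_reals all_analysis.
Set Implicit Arguments. Unset Strict Implicit. Unset Printing Implicit Defensive.
Import Order.TTheory GRing.Theory Num.Theory.
Import numFieldNormedType.Exports.
Local Open Scope classical_set_scope.
Local Open Scope ring_scope.

Definition borelT (T : topologicalType) := g_sigma_algebraType (@open T).

Section defs.
Variable R : realType.

Definition Iset : set R := `[-1, 1].
Definition Jset : set R := `]1, 2].

Definition tent (t x : R) : R := Num.min (t * (x - 1) + 3) (t * (1 - x) - 1).

Definition Fmap (p : R * R) : R * R := (tent p.2 p.1, p.2).
Definition Pset : set (R * R) := Iset `*` Jset.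

Definition hatI (t : R) : set {ptws nat -> R} :=
  [set x | (forall n, Iset (x n)) /\ (forall n, tent t (x n.+1) = x n)].

Definition hatP : set {ptws nat -> (R * R)%type} :=
  [set x | (forall n, Pset (x n)) /\ (forall n, Fmap (x n.+1) = x n)].

Definition hatf (t : R) (x : {ptws nat -> R}) : {ptws nat -> R} :=
  fun n => match n with 0 => tent t (x 0) | m.+1 => x m end.

Definition proj_n (n : nat) (x : {ptws nat -> R}) : R := x n.

Definition iota_t (t : R) (x : {ptws nat -> R}) : {ptws nat -> (R * R)%type} := fun n => (x n, t).

(** mu is an f_t-invariant, absolutely continuous Borel probability on I
    (viewed as a probability on R concentrated on I). *)
Definition is_acim (t : R) (mu : probability R R) : Prop :=
  [/\ mu Iset = 1%E,
      (forall A : set R, measurable A -> mu (tent t @^-1` A) = mu A) &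
      (forall A : set R, measurable A -> (lebesgue_measure A = 0)%E -> mu A = 0%E)].

Definition is_induced (t : R) (mu : probability R R)
    (nu : probability (borelT {ptws nat -> R}) R) : Prop :=
  [/\ nu (hatI t) = 1%E,
      (forall B : set (borelT {ptws nat -> R}), measurable B ->
          nu (hatf t @^-1` B) = nu B) &
      (forall (n : nat) (A : set R), measurable A ->
          nu (proj_n n @^-1` A) = mu A)].

Definition is_pushforward_iota (t : R) (nu : probability (borelT {ptws nat -> R}) R)
    (nu' : {measure set (borelT {ptws nat -> (R * R)%type}) -> \bar R}) : Prop :=
  forall B : set (borelT {ptws nat -> (R * R)%type}), measurable B ->
    nu' B = nu (iota_t t @^-1` B).

End defs.

(* Main.v *)
Require Import Defs.
From HB Require Import structures.
From mathcomp Require Import all_boot all_order all_algebra.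
From mathcomp Require Import all_classical all_reals all_analysis.
From mathcomp Require Import measurable_realfun ring lra.
Import Order.TTheory GRing.Theory Num.Theory.
Import numFieldNormedType.Exports.
Local Open Scope classical_set_scope.
Local Open Scope ring_scope.

(** The right branch of [tent t] has the inverse [tent_section t], which is
    continuous in [(y, t)].  Pulling a value [y] of the [N]-th coordinate back
    along this branch gives a thread [thread N t y] depending continuously on
    [(y, t)] and agreeing with every thread [x] such that [x N = y] in the
    coordinates [0, ..., N].  Slopes [t >= a > 1] cut out a compact part of
    [hatP], so on it [alpha] is uniformly approximated, for [N] large, by
    [alpha (iota_t t (thread N t (x N)))], where [x] is a thread of slope [t].
    For fixed [N] and [t --> tstar] this is uniformly close to [G (x N)] with
    [G] continuous and independent of [t], and integrating [G (x N)] amounts to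
    integrating [G] against [mu t], where weak continuity is given. *)

Set Implicit Arguments.
Unset Strict Implicit.

(** * The tent map, a right inverse, and threads with a prescribed coordinate *)

Lemma tentE (R : realType) (t x : R) : tent t x = 1 - `|t * (x - 1) + 2|.
Proof.
rewrite /tent; have [u0|u0] := leP 0 (t * (x - 1) + 2).
  by rewrite ger0_norm// min_r; lra.
by rewrite ltr0_norm// min_l; lra.
Qed.

Lemma Iset_tent (R : realType) (t x : R) : Jset t -> Iset x -> Iset (tent t x).
Proof.
rewrite /Jset /Iset /= !in_itv /= tentE => /andP[t1 t2] /andP[x1 x2].
by apply/andP; split; case: ger0P => ?; nra.
Qed.

Definition tent_section (R : realType) (t y : R) : R := 1 - (y + 1) / t.

Lemma tent_sectionK (R : realType) (t y : R) :
  Jset t -> Iset y -> tent t (tent_section t y) = y.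
Proof.
rewrite /Jset /Iset /= !in_itv /= tentE /tent_section.
move=> /andP[t1 t2] /andP[y1 y2].
have -> : t * (1 - (y + 1) / t - 1) + 2 = 1 - y by field; lra.
by rewrite ger0_norm; lra.
Qed.

Lemma Iset_tent_section (R : realType) (t y : R) :
  Jset t -> Iset y -> Iset (tent_section t y).
Proof.
rewrite /Jset /Iset /= !in_itv /= /tent_section => /andP[t1 t2] /andP[y1 y2].
have t0 : 0 < t by lra.
have : 0 <= (y + 1) / t by apply: divr_ge0; lra.
have : (y + 1) / t <= 2 by rewrite ler_pdivrMr//; nra.
by lra.
Qed.

(** Coordinates up to [N] are forced by [y]; a choice of preimage enters only beyond [N]. *)
Definition thread (R : realType) (N : nat) (t y : R) : {ptws nat -> R} := fun n =>
  if (n <= N)%N then iter (N - n) (tent t) y else iter (n - N) (tent_section t) y.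

Lemma hatI_thread (R : realType) (N : nat) (t y : R) :
  Jset t -> Iset y -> hatI t (thread N t y).
Proof.
move=> Jt Iy.
have It k : Iset (iter k (tent t) y) by elim: k => //= k; exact: Iset_tent.
have Is k : Iset (iter k (tent_section t) y).
  by elim: k => //= k; exact: Iset_tent_section.
split=> n; rewrite /thread; first by case: ifP.
case: ltnP => [nN|Nn].
  by rewrite (ltnW nN) -iterS -subSn// subSS.
rewrite subSn//= tent_sectionK//.
(* The two branches of [thread] meet at [n = N], where both are the zeroth iterate. *)
case: leqP => // nN.
by have -> : n = N by [apply/eqP; rewrite eqn_leq nN Nn]; rewrite subnn.
Qed.

Lemma thread_hatI (R : realType) (N n : nat) (t : R) (x : {ptws nat -> R}) :
  hatI t x -> (n <= N)%N -> thread N t (x N) n = x n.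
Proof.
move=> [_ xt] nN; rewrite /thread nN -{2}(subnKC nN); move: (N - n)%N => k {N nN}.
elim: k => [|k IH]; first by rewrite addn0.
by rewrite iterSr addnS xt.
Qed.

Lemma hatP_iota (R : realType) (t : R) (x : {ptws nat -> R}) :
  Jset t -> hatI t x -> hatP (iota_t t x).
Proof.
move=> Jt [xI xt]; split=> n; first by split; [exact: xI|].
by rewrite /Fmap /iota_t /= xt.
Qed.

(** Since [Fmap] preserves the slope, all coordinates of a thread share the slope of coordinate 0.
    Thus [hatP] is the disjoint union over [t] in J of the copies of [hatI t] under [iota_t t]. *)
Lemma hatP_fiber (R : realType) (x : {ptws nat -> (R * R)%type}) : hatP x ->
  [/\ Jset (x 0%N).2, hatI (x 0%N).2 (fst \o x) & iota_t (x 0%N).2 (fst \o x) = x].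
Proof.
move=> [xP xF].
have x2 n : (x n).2 = (x 0%N).2.
  by elim: n => // n <-; rewrite -(xF n).
split; first by have [] := xP 0%N.
  split=> n /=; first by have [] := xP n.
  by rewrite -[in RHS]xF /= x2.
by apply/funext => n; rewrite /iota_t/= -(x2 n) -surjective_pairing.
Qed.

(** * Joint continuity of threads in value and slope *)

Section continuity.
Context (R : realType) (T : Type) (F : set_system T) (FF : Filter F).

(** An arbitrary filter is allowed because value and slope will move together, along restricted
    product filters. *)
Lemma cvg_iter_tent (k : nat) (f g : T -> R) (y t : R) :
  f @ F --> y -> g @ F --> t ->
  iter k (tent (g z)) (f z) @[z --> F] --> iter k (tent t) y.
Proof.
move=> fy gt; elim: k => //= k IH; rewrite tentE.
under eq_cvg do rewrite tentE.
apply: cvgB; first exact: cvg_cst.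
apply: cvg_norm; apply: cvgD; last exact: cvg_cst.
by apply: cvgM => //; apply: cvgB => //; exact: cvg_cst.
Qed.

Lemma cvg_iter_tent_section (k : nat) (f g : T -> R) (y t : R) : t != 0 ->
  f @ F --> y -> g @ F --> t ->
  iter k (tent_section (g z)) (f z) @[z --> F] --> iter k (tent_section t) y.
Proof.
move=> t0 fy gt; elim: k => //= k IH.
apply: cvgB; first exact: cvg_cst.
by apply: cvgM; [apply: cvgD => //; exact: cvg_cst|exact: cvgV].
Qed.

Lemma cvg_iota_thread (N : nat) (f g : T -> R) (y t : R) : t != 0 ->
  f @ F --> y -> g @ F --> t ->
  iota_t (g z) (thread N (g z) (f z)) @[z --> F] --> iota_t t (thread N t y).
Proof.
move=> t0 fy gt; apply/pointwise_cvgP => n.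
suff : thread N (g z) (f z) n @[z --> F] --> thread N t y n.
  by move=> /cvg_pair /(_ gt).
rewrite /thread; case: ifP => _.
  exact: cvg_iter_tent.
exact: cvg_iter_tent_section.
Qed.

End continuity.

(** * Closedness of the thread condition and compact parts of the inverse limit *)

Lemma continuous_coord (R : realType) (n : nat) :
  continuous (fun x : {ptws nat -> (R * R)%type} => x n).
Proof. exact: (@proj_continuous nat (fun=> (R * R)%type) n). Qed.

Lemma continuous_fst_coord (R : realType) (n : nat) :
  continuous (fun x : {ptws nat -> (R * R)%type} => (x n).1).
Proof. by move=> x; apply: cvg_comp; [exact: continuous_coord|exact: cvg_fst]. Qed.

Lemma continuous_snd_coord (R : realType) (n : nat) :
  continuous (fun x : {ptws nat -> (R * R)%type} => (x n).2).
Proof. by move=> x; apply: cvg_comp; [exact: continuous_coord|exact: cvg_snd]. Qed.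

(** Both summands are nonnegative, so this defect vanishes exactly when the thread condition holds
    at [n]; that condition thereby becomes the zero set of one continuous real function. *)
Lemma continuous_thread_defect (R : realType) (n : nat) :
  continuous (fun x : {ptws nat -> (R * R)%type} =>
    `|tent (x n.+1).2 (x n.+1).1 - (x n).1| + `|(x n.+1).2 - (x n).2|).
Proof.
move=> x; have Fx := nbhs_filter x.
have cx := @continuous_fst_coord R _ x; have cy := @continuous_snd_coord R _ x.
have ct := cvg_iter_tent Fx (k := 1%N) (cx n.+1) (cy n.+1).
exact: cvgD (cvg_norm (cvgB ct (cx n))) (cvg_norm (cvgB (cy n.+1) (cy n))).
Qed.

Lemma closed_threads (R : realType) :
  closed [set x : {ptws nat -> (R * R)%type} | forall n, Fmap (x n.+1) = x n].
Proof.
have -> : [set x : {ptws nat -> (R * R)%type} | forall n, Fmap (x n.+1) = x n] =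
    \bigcap_(n in setT) ((fun x => `|tent (x n.+1).2 (x n.+1).1 - (x n).1| +
      `|(x n.+1).2 - (x n).2|) @^-1` [set 0]).
  apply/seteqP; split => [x /= xF n _|x /= xF n] /=.
    by rewrite -(xF n)/= !subrr normr0 addr0.
  move: (xF n I) => /= /eqP; rewrite paddr_eq0 // !normr_eq0 !subr_eq0.
  by move=> /andP[/eqP e1 /eqP e2]; rewrite /Fmap e1 e2 -surjective_pairing.
apply: closed_bigI => n _; apply: preimage_closed; last exact: closed_eq.
by move=> x _; exact: continuous_thread_defect.
Qed.

(** J is open at 1, so [hatP] is not compact. The bound [a] replaces J by the segment from [a] to 2,
    leaving a closed subset of a product of compact sets. *)
Lemma compact_hatP_ge (R : realType) (a : R) : 1 < a ->
  compact (@hatP R `&` [set x | a <= (x 0%N).2]).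
Proof.
move=> a1.
have -> : @hatP R `&` [set x | a <= (x 0%N).2] =
    [set x : {ptws nat -> (R * R)%type} | forall n, (@Iset R `*` `[a, 2]) (x n)] `&`
    [set x : {ptws nat -> (R * R)%type} | forall n, Fmap (x n.+1) = x n].
  apply/seteqP; split => x /=.
    move=> [xP xa]; have [_ xF] := xP; split => // n.
    have [J0 [xI _] <-] := hatP_fiber xP.
    split; first exact: xI.
    by move: J0; rewrite /Jset /iota_t /= !in_itv /= => /andP[_ ->]; rewrite xa.
  move=> [xI xF]; split; last by have [_] := xI 0%N; rewrite /= in_itv => /andP[].
  split => // n; have [? /= xJ] := xI n; split => //=.
  by move: xJ; rewrite /Jset /= !in_itv /= => /andP[? ->]; rewrite (lt_le_trans a1).
apply: compact_closedI; last exact: closed_threads.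
apply: (@tychonoff nat (fun=> (R * R)%type) (fun=> @Iset R `*` `[a, 2])) => _.
by apply: compact_setX; exact: segment_compact.
Qed.

(** * Uniform approximation of the test function through one coordinate *)

Section covering.
Context (R : realType) (alpha : {ptws nat -> (R * R)%type} -> R).
Hypothesis Halpha : {within (@hatP R), continuous alpha}.

(** Continuity of [alpha] is only relative to [hatP], so limits pass through it only along maps that
    eventually take values in [hatP]. *)
Lemma cvg_within_hatP (x : {ptws nat -> (R * R)%type}) (T : Type) (F : set_system T)
    (FF : Filter F) (f : T -> {ptws nat -> (R * R)%type}) :
  hatP x -> (\forall z \near F, hatP (f z)) -> f @ F --> x ->
  (alpha \o f) @ F --> alpha x.
Proof.
move=> xP fP fx; have /subspace_continuousP/(_ _ xP) := Halpha.
move=> c A /c cA; have := fx _ cA.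
by apply: filterS2 fP => z zP; exact.
Qed.

(** By compactness it suffices to argue locally: as [x'] tends to [x] in [hatP] and [N] to infinity,
    both [x'] and [r N x'] tend to [x], so the values of [alpha] at them have the same limit. *)
Lemma thread_approx (a e : R) : 1 < a -> 0 < e ->
  \forall N \near \oo, forall t x, Jset t -> a <= t -> hatI t x ->
    `|alpha (iota_t t x) - alpha (iota_t t (thread N t (x N)))| < e.
Proof.
move=> a1 e0.
have /compact_near_coveringP/near_covering_withinP := compact_hatP_ge a1.
pose r N (x : {ptws nat -> (R * R)%type}) : {ptws nat -> (R * R)%type} :=
  iota_t (x 0%N).2 (thread N (x 0%N).2 (x N).1).
move=> /(_ nat \oo (fun N x => `|alpha x - alpha (r N x)| < e)) H.
apply: (@filterS _ \oo _ _ _ _ (H _ _)).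
  move=> N HN t x Jt at_ Ix.
  by apply: (HN (iota_t t x)); split => //; exact: hatP_iota.
move=> x [xP _].
pose G := within (@hatP R `*` setT) (filter_prod (nbhs x) \oo).
have GF : Filter G by exact: within_filter.
have GP : \forall z \near G, hatP z.1 by apply: filterS (withinT _ _) => z [].
have Gx : fst @ G --> x.
  by apply: cvg_within_filter; exact: cvg_fst.
have Gr : (fun z => r z.2 z.1) @ G --> x.
  apply/pointwise_cvgP => n.
  (* Convergence is coordinatewise, and coordinate [n] is left unchanged by [r N] as soon as
     [n <= N]. *)
  have GN : \forall z \near G, (n <= z.2)%N.
    have Gs : snd @ G --> \oo by apply: cvg_within_filter; exact: cvg_snd.
    exact: Gs _ (nbhs_infty_ge n).
  move=> A /(cvg_comp _ _ Gx (@continuous_coord R n x)).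
  apply: filterS3 GP GN => z zP nz.
  have [Jz Iz ez] := hatP_fiber zP.
  by rewrite /= /r /iota_t (thread_hatI Iz)// -[in X in X -> _]ez.
have GrP : \forall z \near G, hatP (r z.2 z.1).
  near=> z; have zP : hatP z.1 by near: z.
  have [Jz Iz ez] := hatP_fiber zP.
  apply: hatP_iota => //; apply: hatI_thread => //.
  have [Ix _] := Iz; exact: Ix.
have : (alpha z.1 - alpha (r z.2 z.1)) @[z --> G] --> alpha x - alpha x.
  by apply: cvgB; [exact: cvg_within_hatP Gx|exact: cvg_within_hatP Gr].
rewrite subrr => /cvgr0_norm_lt /(_ _ e0).
apply: (@filterS _ (filter_prod (nbhs x) \oo)) => -[x' i] /= h [x'P _].
exact: h.
Unshelve. all: by end_near. Qed.

Lemma cvg_alpha_thread (N : nat) (T : Type) (F : set_system T) (FF : Filter F)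
    (f g : T -> R) (y t : R) : Jset t -> Iset y ->
  (\forall z \near F, Jset (g z)) -> (\forall z \near F, Iset (f z)) ->
  f @ F --> y -> g @ F --> t ->
  alpha (iota_t (g z) (thread N (g z) (f z))) @[z --> F] -->
  alpha (iota_t t (thread N t y)).
Proof.
move=> Jt Iy Jg If fy gt.
have t0 : t != 0.
  by move: Jt; rewrite /Jset /= in_itv /= => /andP[t1 _]; rewrite gt_eqF//; lra.
have hP : hatP (iota_t t (thread N t y)).
  by apply: hatP_iota => //; exact: hatI_thread.
have fP : \forall z \near F, hatP (iota_t (g z) (thread N (g z) (f z))).
  by apply: filterS2 Jg If => z Jz Iz; apply: hatP_iota => //; exact: hatI_thread.
exact: (cvg_within_hatP FF hP fP (cvg_iota_thread (N := N) FF t0 fy gt)).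
Qed.

Lemma continuous_alpha_thread (N : nat) (t : R) : Jset t ->
  {within @Iset R, continuous (fun y => alpha (iota_t t (thread N t y)))}.
Proof.
move=> Jt; apply/subspace_continuousP => y Iy.
apply: (@cvg_alpha_thread N _ _ _ id (cst t)) => //.
- exact: nearW.
- exact: withinT.
- exact: cvg_within.
- exact: cvg_cst.
Qed.

(** Both terms tend to the same value as [y'] tends to [y] in I and [i] to infinity; compactness of
    I makes the resulting bound uniform in [y]. *)
Lemma alpha_thread_uniform (N : nat) (s : nat -> R) (t e : R) :
  (forall i, Jset (s i)) -> Jset t -> s @ \oo --> t -> 0 < e ->
  \forall i \near \oo, forall y, Iset y ->
    `|alpha (iota_t (s i) (thread N (s i) y)) - alpha (iota_t t (thread N t y))| < e.
Proof.
move=> Js Jt st e0.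
have /compact_near_coveringP/near_covering_withinP := @segment_compact R (-1) 1.
move=> /(_ nat \oo (fun i y => `|alpha (iota_t (s i) (thread N (s i) y))
  - alpha (iota_t t (thread N t y))| < e)) H.
suff : forall y : R, Iset y -> \forall y' \near y & i \near \oo, Iset y' ->
    `|alpha (iota_t (s i) (thread N (s i) y')) - alpha (iota_t t (thread N t y'))| < e.
  by move=> /H.
move=> {H} y Iy.
pose G := within (@Iset R `*` setT) (filter_prod (nbhs y) \oo).
have GF : Filter G by exact: within_filter.
have GI : \forall z \near G, Iset z.1 by apply: filterS (withinT _ _) => z [].
have Gy : fst @ G --> y by apply: cvg_within_filter; exact: cvg_fst.
have Gi : snd @ G --> \oo by apply: cvg_within_filter; exact: cvg_snd.
have Gs : (s \o snd) @ G --> t by exact: cvg_comp Gi st.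
have c1 : alpha (iota_t (s z.2) (thread N (s z.2) z.1)) @[z --> G] -->
    alpha (iota_t t (thread N t y)).
  apply: (@cvg_alpha_thread N _ _ _ fst (s \o snd)) => //.
  by apply: nearW => z; exact: Js.
have c2 : alpha (iota_t t (thread N t z.1)) @[z --> G] -->
    alpha (iota_t t (thread N t y)).
  apply: (@cvg_alpha_thread N _ _ _ fst (cst t)) => //; first exact: nearW.
  exact: cvg_cst.
have c3 : alpha (iota_t (s z.2) (thread N (s z.2) z.1))
    - alpha (iota_t t (thread N t z.1)) @[z --> G] --> (0 : R).
  by rewrite -(subrr (alpha (iota_t t (thread N t y)))); exact: cvgB.
have : \forall z \near G, `|alpha (iota_t (s z.2) (thread N (s z.2) z.1))
    - alpha (iota_t t (thread N t z.1))| < e by exact: (cvgr0_norm_lt _ c3).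
apply: (@filterS _ (filter_prod (nbhs y) \oo)) => -[y' i] /= h y'I.
exact: h.
Qed.

End covering.

(** * Borel measurability on the sequence space, and two facts on integrals *)

Section borelT_threads.
Context (R : realType).
Local Notation X := {ptws nat -> (R * R)%type}.

Lemma open_borelT_measurable (U : set X) : open U -> measurable (U : set (borelT X)).
Proof. exact: sub_sigma_algebra. Qed.

Lemma closed_borelT_measurable (U : set X) : closed U -> measurable (U : set (borelT X)).
Proof.
move=> /closed_openC/open_borelT_measurable mU.
by rewrite -(setCK U); exact: measurableC.
Qed.

Lemma within_continuous_borelT_measurable (D : set X) (f : X -> R) :
  measurable (D : set (borelT X)) -> {within D, continuous f} ->
  measurable_fun (D : set (borelT X)) f.
Proof.
move=> mD /continuousP cf.
apply: (measurability _ (measurable_realfun.RGenOpens.measurableE R)).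
move=> _ [_ [a [b ->] <-]].
have /open_subspaceP[V oV VD] := cf _ (@itv_open _ R a b).
rewrite setIC -VD; apply: measurableI => //; exact: open_borelT_measurable.
Qed.

Lemma continuous_borelT_measurable (f : X -> R) :
  continuous f -> measurable_fun (setT : set (borelT X)) f.
Proof.
move=> cf; apply: within_continuous_borelT_measurable => //.
exact: continuous_subspaceT.
Qed.

End borelT_threads.

Lemma integral_full_measure d (T : measurableType d) (R : realType)
    (mu : {measure set T -> \bar R}) (D E : set T) (f : T -> \bar R) :
  measurable D -> measurable E -> D `<=` E -> mu (~` D) = 0%E ->
  measurable_fun E f ->
  (\int[mu]_(x in E) f x = \int[mu]_(x in D) f x)%E.
Proof.
move=> mD mE DE D0 mf.
rewrite -[in RHS](setIidr DE) integral_mkcondr.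
apply: ae_eq_integral => //.
  apply/(measurable_restrict _ mD mE).
  by apply: measurable_funS mf => //; exact: subIsetl.
exists (~` D); split=> // [|x]; first exact: measurableC.
apply: contra_not => Dx _; by rewrite patchE mem_set.
Qed.

(** The bound [M + e] on [f] makes both integrals finite, so their difference can be taken between
    reals; it is at most [e] because [D] has mass one. *)
Lemma integral_dist_le d (T : measurableType d) (R : realType)
    (mu : {measure set T -> \bar R}) (D : set T) (f g : T -> R) (M e : R) :
  measurable D -> mu D = 1%E -> measurable_fun D f -> measurable_fun D g ->
  (forall x, D x -> `|g x| <= M) -> (forall x, D x -> `|f x - g x| <= e) ->
  exists a b, [/\ (\int[mu]_(x in D) (f x)%:E = a%:E)%E,
    (\int[mu]_(x in D) (g x)%:E = b%:E)%E & `|a - b| <= e].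
Proof.
move=> mD D1 mf mg gM fg.
have e0 : 0 <= e.
  have [x Dx] : D !=set0.
    apply/set0P/negP => /eqP D0; move: D1; rewrite D0 measure0 => /esym/eqP.
    by rewrite onee_eq0.
  exact: le_trans (fg x Dx).
have Dfin : (mu D < +oo)%E by rewrite D1 ltry.
have ig : mu.-integrable D (EFin \o g).
  apply: measurable_bounded_integrable => //.
  exists M; split; first exact: num_real.
  by move=> r Mr x Dx; exact: le_trans (gM x Dx) (ltW Mr).
have jf : mu.-integrable D (EFin \o f).
  apply: measurable_bounded_integrable => //.
  exists (M + e); split; [exact: num_real|move=> r Mr x Dx].
  apply: le_trans (ltW Mr); rewrite /= -(subrK (g x) (f x)) addrC.
  by rewrite (le_trans (ler_normD _ _))// lerD// ?gM// fg.
have /fineK fa := integrable_fin_num mD jf.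
have /fineK ga := integrable_fin_num mD ig.
exists (fine (\int[mu]_(x in D) (EFin \o f) x)%E).
exists (fine (\int[mu]_(x in D) (EFin \o g) x)%E); split => //.
rewrite -lee_fin -abse_EFin EFinB fa ga -integralB//.
rewrite (le_trans (le_abse_integral _ _ _))//.
  by apply: measurable_int (integrableB _ jf ig).
rewrite (le_trans (integral_le_bound e%:E _ _ _ _))//.
- by apply: measurable_int (integrableB _ jf ig).
- by apply: aeW => x Dx; rewrite /= lee_fin fg.
- by rewrite D1 mule1.
Qed.

(** * Fibres of fixed slope and transfer of integrals to the interval *)

Lemma measurable_hatP (R : realType) :
  measurable (@hatP R : set (borelT {ptws nat -> (R * R)%type})).
Proof.
(* [hatP] is not closed, J being half-open, so it is cut into countably many Borel conditions on
   coordinates and the closed thread condition. *)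
have -> : @hatP R = (\bigcap_n
    ((fun x : {ptws nat -> (R * R)%type} => (x n).1) @^-1` (@Iset R) `&`
     (fun x : {ptws nat -> (R * R)%type} => (x n).2) @^-1` (@Jset R))) `&`
    [set x : {ptws nat -> (R * R)%type} | forall n, Fmap (x n.+1) = x n].
  apply/seteqP; split => x /= [xP xF]; split => // n; last exact: xP.
  by move=> _; exact: xP.
apply: measurableI; last exact: (closed_borelT_measurable (@closed_threads R)).
apply: bigcapT_measurable => n; apply: measurableI.
  rewrite -[X in measurable X]setTI.
  apply: (continuous_borelT_measurable (@continuous_fst_coord R n)) => //.
  exact: measurable_itv.
rewrite -[X in measurable X]setTI.
apply: (continuous_borelT_measurable (@continuous_snd_coord R n)) => //.
exact: measurable_itv.
Qed.

(** For [t] in J this is the image of [hatI t] under [iota_t t], cut out by a condition on the slope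
    so that its measurability does not rest on that of an image. *)
Definition hatP_at (R : realType) (t : R) : set {ptws nat -> (R * R)%type} :=
  @hatP R `&` [set x | (x 0%N).2 = t].

Lemma measurable_hatP_at (R : realType) (t : R) :
  measurable (hatP_at t : set (borelT {ptws nat -> (R * R)%type})).
Proof.
apply: measurableI; first exact: measurable_hatP.
rewrite -[X in measurable X]setTI.
exact: (continuous_borelT_measurable (@continuous_snd_coord R 0) measurableT
  (measurable_set1 t)).
Qed.

Lemma iota_preimage_hatP_at (R : realType) (t : R) : Jset t ->
  iota_t t @^-1` hatP_at t = hatI t.
Proof.
move=> Jt; apply/seteqP; split => x.
  by move=> [/hatP_fiber[_ ? _] _].
by move=> xI; split => //; exact: hatP_iota.
Qed.

Lemma hatP_at_iota (R : realType) (t : R) (x : {ptws nat -> (R * R)%type}) :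
  hatP_at t x -> exists2 z, hatI t z & x = iota_t t z.
Proof. by move=> [/hatP_fiber[_ xI xE] /= <-]; exists (fst \o x). Qed.

Lemma integral_pushforward_eq d1 d2 (X : measurableType d1) (Y : measurableType d2)
    (R : realType) (phi : X -> Y) (mphi : measurable_fun setT phi)
    (mu : {measure set X -> \bar R}) (nu : {measure set Y -> \bar R})
    (D : set Y) (f : Y -> \bar R) :
  measurable D -> measurable_fun setT f ->
  mu.-integrable (phi @^-1` D) (f \o phi) ->
  (forall A, measurable A -> nu A = mu (phi @^-1` A)) ->
  (\int[nu]_(y in D) f y = \int[mu]_(x in phi @^-1` D) (f \o phi) x)%E.
Proof.
move=> mD mf intf numu; rewrite -(integral_pushforward mphi mf intf mD).
by apply: eq_measure_integral => A mA _; exact: numu.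
Qed.

(** The measure [nu'] is a probability carried by the fibre [hatP_at t], and coordinate [N] pushes
    it forward to [mu]. On that fibre [alpha] is within [e] of [G] at coordinate [N], whose integral
    is that of [G] against [mu]. *)
Lemma integral_thread_dist (R : realType) (t e : R) (N : nat)
    (mu : probability R R) (nu : probability (borelT {ptws nat -> R}) R)
    (nu' : {measure set (borelT {ptws nat -> (R * R)%type}) -> \bar R})
    (alpha : {ptws nat -> (R * R)%type} -> R) (G : R -> R) :
  Jset t -> is_induced t mu nu -> is_pushforward_iota t nu nu' ->
  {within @hatP R, continuous alpha} -> {within @Iset R, continuous G} ->
  (forall x, hatI t x -> `|alpha (iota_t t x) - G (x N)| <= e) ->
  exists a b, [/\ (\int[nu']_(x in @hatP R) (alpha x)%:E = a%:E)%E,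
    (\int[mu]_(x in @Iset R) (G x)%:E = b%:E)%E & `|a - b| <= e].
Proof.
move=> Jt [nu1 _ numu] nunu' calpha cG alphaG.
pose X := borelT {ptws nat -> (R * R)%type}.
pose phi (x : X) : R := (x N).1.
have mphi : measurable_fun setT phi.
  exact: (continuous_borelT_measurable (@continuous_fst_coord R N)).
pose D : set X := hatP_at t.
have mD : measurable D by exact: measurable_hatP_at.
have nuD : nu' D = 1%E by rewrite nunu'// iota_preimage_hatP_at.
have nuT : nu' setT = 1%E by rewrite nunu'// preimage_setT probability_setT.
have nuDC : nu' (~` D) = 0%E.
  have : nu' setT = (nu' D + nu' (~` D))%E.
    by rewrite -measureU ?setUv ?setICr//; exact: measurableC.
  rewrite nuT nuD; have : (0 <= nu' (~` D))%E by exact: measure_ge0.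
  case: (nu' (~` D)) => //= r _; rewrite -EFinD => -[r1].
  by congr (_%:E); lra.
have mI : measurable (@Iset R) by exact: measurable_itv.
have mG : measurable_fun (@Iset R) G by exact: subspace_continuous_measurable_fun.
(* Nothing is known of [G] off I; extension by zero gives a bounded Borel function on the whole
   line, which can be composed with [phi]. *)
pose G' := G \_ (@Iset R).
have mG' : measurable_fun setT G' by exact: (iffLR (measurable_restrictT _ mI)).
have [M GM] : exists M, forall y, `|G' y| <= M.
  have /compact_bounded[M [_ HM]] := continuous_compact cG (@segment_compact R (-1) 1).
  exists (Num.max 0 (M + 1)) => y; rewrite /G' patchE; case: ifPn => [|_].
    rewrite inE => Iy; rewrite le_max; apply/orP; right.
    by apply: HM; [rewrite ltrDl|exists y].
  by rewrite normr0 le_max lexx.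
have mG'phi : measurable_fun setT (G' \o phi) by exact: measurableT_comp.
have IN x : D x -> Iset (phi x) by move=> [[xP _] _]; have [] := xP N.
have mphiI : measurable (phi @^-1` @Iset R).
  by rewrite -[X in measurable X]setTI; exact: mphi.
have malpha : measurable_fun (@hatP R : set X) alpha.
  by apply: within_continuous_borelT_measurable => //; exact: measurable_hatP.
have mhatP : measurable (@hatP R : set X) by exact: measurable_hatP.
have [] := @integral_dist_le _ X R nu' D alpha (G' \o phi) M e mD nuD.
- by apply: measurable_funS malpha => // x [].
- exact: measurable_funTS.
- by move=> x _; exact: GM.
- move=> x Dx; rewrite /= /G' patchE mem_set; last exact: IN.
  by have [z zI ->] := hatP_at_iota Dx; exact: alphaG.
move=> a [b [ea eb ab]]; exists a, b; split => //.
- rewrite -ea; apply: integral_full_measure => //.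
    by move=> x [].
  exact/measurable_EFinP.
- rewrite -eb (eq_integral (EFin \o G')); last first.
    by move=> y yI; rewrite /= /G' patchE yI.
  (* The change of variables takes place where coordinate [N] lies in I; this set contains the
     fibre, which already has full mass. *)
  transitivity (\int[nu']_(x in phi @^-1` @Iset R) (G' (phi x))%:E)%E.
    apply: (integral_pushforward_eq mphi) => //.
    + exact/measurable_EFinP.
    + apply: (@measurable_bounded_integrable _ X R nu' (G' \o phi)) => //.
      * apply: (@le_lt_trans _ _ (nu' setT)); last by rewrite nuT ltry.
        by apply: le_measure; rewrite ?inE.
      * exact: measurable_funTS.
      * exists M; split; first exact: num_real.
        by move=> r Mr x _; exact: le_trans (GM _) (ltW Mr).
    + move=> A mA; rewrite nunu' ?numu//.
      by rewrite -[X in measurable X]setTI; exact: mphi.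
  apply: integral_full_measure => //.
  by apply: measurable_funTS; exact/measurable_EFinP.
Qed.

(** * Convergence of the integrals *)

Unset Implicit Arguments.
Set Strict Implicit.

Theorem mainTheorem3 (R : realType)
  (mu : R -> probability R R)
  (hmu : R -> probability (borelT {ptws nat -> R}) R)
  (thmu : R -> {measure set (borelT {ptws nat -> (R * R)%type}) -> \bar R})
  (Hmu : forall t, Jset t -> is_acim t (mu t))
  (Hweak : forall (g : R -> R), {within (@Iset R), continuous g} ->
     forall (s : nat -> R) (t : R), (forall i, Jset (s i)) -> Jset t ->
       s @ \oo --> t ->
       (fun i => (\int[mu (s i)]_(x in (@Iset R)) (g x)%:E)%E) @ \oo -->
         (\int[mu t]_(x in (@Iset R)) (g x)%:E)%E)
  (Hhmu : forall t, Jset t -> is_induced t (mu t) (hmu t))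
  (Hthmu : forall t, Jset t -> is_pushforward_iota t (hmu t) (thmu t))
  (ts : nat -> R) (tstar : R)
  (Hts : forall i, Jset (ts i)) (Htstar : Jset tstar)
  (Hcv : ts @ \oo --> tstar)
  (alpha : {ptws nat -> (R * R)%type} -> R)
  (Halpha : {within (@hatP R), continuous alpha}) :
  (fun i => (\int[thmu (ts i)]_(x in (@hatP R)) (alpha x)%:E)%E) @ \oo -->
    (\int[thmu tstar]_(x in (@hatP R)) (alpha x)%:E)%E.
Proof.
have t1 : 1 < tstar by move: Htstar; rewrite /Jset /= in_itv /= => /andP[].
(* The midpoint of 1 and [tstar] bounds from below [tstar] and all but finitely many [ts i], so one
   compact part of [hatP] serves them all. *)
pose a := (1 + tstar) / 2.
have a1 : 1 < a by rewrite /a; lra.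
have at_ : a < tstar by rewrite /a; lra.
have Hat : \forall i \near \oo, a <= ts i.
  near=> i; apply: ltW; near: i; exact: (cvgr_gt _ Hcv).
(* The same [N] and [G] serve [tstar] and all late [ts i]. Half of [e] pays for replacing a point by
   its [thread], the other half for changing the slope to [tstar]. *)
have approx (e : R) : 0 < e -> exists N, exists G : R -> R,
    [/\ {within @Iset R, continuous G},
      (forall x, hatI tstar x -> `|alpha (iota_t tstar x) - G (x N)| <= e) &
      \forall i \near \oo, forall x, hatI (ts i) x ->
        `|alpha (iota_t (ts i) x) - G (x N)| <= e].
  move=> e0; have e20 : 0 < e / 2 by rewrite divr_gt0.
  have [N _ /(_ N (leqnn N)) HN] := thread_approx Halpha a1 e20.
  exists N, (fun y => alpha (iota_t tstar (thread N tstar y))); split.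
  - exact: continuous_alpha_thread.
  - move=> x xI; apply: ltW; apply: lt_trans (HN _ _ Htstar (ltW at_) xI) _; lra.
  - have := alpha_thread_uniform Halpha N Hts Htstar Hcv e20.
    apply: filterS2 Hat => i ai Hi x xI.
    have [/(_ N) xN _] := xI.
    rewrite [e]splitr; apply: le_trans (ler_distD _ _ _) _.
    by apply: lerD; apply: ltW; [exact: HN|exact: Hi].
have [A0 EA0] : exists A0, (\int[thmu tstar]_(x in @hatP R) (alpha x)%:E = A0%:E)%E.
  have [N [G [cG Gt _]]] := approx 1 ltr01.
  have [A0 [_ [-> _ _]]] := integral_thread_dist Htstar (Hhmu _ Htstar)
    (Hthmu _ Htstar) Halpha cG Gt.
  by exists A0.
rewrite EA0.
(* Convergence in the extended reals splits into eventual finiteness, for which the tolerance 1 is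
   enough, and convergence of the real values. *)
apply/fine_cvgP; split.
  have [N [G [cG _ Gi]]] := approx 1 ltr01.
  apply: filterS Gi => i Gi.
  have [Ai [_ [-> _ _]]] := integral_thread_dist (Hts i) (Hhmu _ (Hts i))
    (Hthmu _ (Hts i)) Halpha cG Gi.
  by [].
(* One third each for passing from [alpha] to [G] at [tstar], for weak convergence of the measures
   [mu (ts i)] tested on [G], and for returning from [G] to [alpha] at [ts i]. *)
apply/cvgrPdist_le => e e0; have e30 : 0 < e / 3 by rewrite divr_gt0.
have [N [G [cG Gt Gi]]] := approx _ e30.
have [A' [B0 []]] := integral_thread_dist Htstar (Hhmu _ Htstar)
  (Hthmu _ Htstar) Halpha cG Gt.
rewrite EA0 => -[<-] EB0 AB0.
have := Hweak _ cG _ _ Hts Htstar Hcv; rewrite EB0 => /fine_cvgP[_].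
move=> /cvgrPdist_le /(_ _ e30).
apply: filterS2 Gi => i Gi.
have [Ai [Bi [EAi EBi ABi]]] := integral_thread_dist (Hts i) (Hhmu _ (Hts i))
  (Hthmu _ (Hts i)) Halpha cG Gi.
rewrite /= EAi EBi /= => B0i.
have -> : A0 - Ai = (A0 - B0) + (B0 - Bi) + - (Ai - Bi) by ring.
have -> : e = e / 3 + e / 3 + e / 3 by field.
rewrite (le_trans (ler_normD _ _))// lerD ?normrN//.
by rewrite (le_trans (ler_normD _ _))// lerD.
Unshelve. all: by end_near. Qed.
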